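(* Let $\Delta$ be a simplicial complex on the vertex set $[n]$ and let $\Delta^{e}$ be its exterior shifting. Then for all $1\le i\le n$ and $j\in\mathbb{Z}$, $$\alpha_{i,j}(K\{\Delta\})=\big|\{F\in\Delta^e : |F|=j,\ [i]\cap F=\emptyset,\ F\cup\{i\}\notin\Delta^e\}\big|.$$
   Context: $K$ is an infinite field, $E=K\langle e_1,\ldots,e_n\rangle$ is the standard graded exterior algebra, $[i]=\{1,\dots,i\}$. A simplicial complex $\Delta$ on $[n]$ is a collection of subsets of $[n]$ closed under taking subsets; it is always assumed that $\{i\}\in\Delta$ for all $i\in[n]$. For $F=\{i_1<\dots<i_r\}$ put $e_F=e_{i_1}\wedge\dots\wedge e_{i_r}$. The exterior face ring is $K\{\Delta\}=E/J_\Delta$ with $J_\Delta=(e_F:F\subseteq[n],F\notin\Delta)$. For a graded $E$-module $M$ and $v\in E_1$, $H^j(M,v)$ denotes the homology at $M_j$ of the complex $\cdots\to M_{j-1}\xrightarrow{\cdot v}M_j\xrightarrow{\cdot v}M_{j+1}\to\cdots$. For a basis $v_1,\dots,v_n$ of $E_1$ put $\alpha_{i,j}(v_1,\dots,v_n;M)=\dim_KH^j(M/(v_1,\dots,v_{i-1})M,v_i)$ for $1\le i\le n$, $j\in\mathbb{Z}$. For a graded ideal $J\subseteq E$, the exterior generic annihilator numbers of $E/J$ are $$\alpha_{i,j}(E/J)=\alpha_{i,j}(e_1,\dots,e_n;E/\operatorname{gin}_{<_{\mathrm{rlex}}}(J)).$$ Here $<_{\mathrm{rlex}}$ is the reverse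 lexicographic order with respect to $e_1<\dots<e_n$ (among monomials of the same degree, $e_A<_{\mathrm{rlex}}e_B$ iff $\min((A\setminus B)\cup(B\setminus A))\in A$), and $\operatorname{gin}_{<_{\mathrm{rlex}}}(J)$ is the generic initial ideal, i.e. the common value of $\operatorname{in}_{<_{\mathrm{rlex}}}(\varphi(J))$ for $\varphi$ in a suitable non-empty Zariski-open subset of $\mathrm{GL}_n(K)$. Exterior algebraic shifting: let $K'/K$ be a field extension containing elements $a_{ij}$, $1\le i,j\le n$, algebraically independent over $K$, let $f_i=\sum_{j=1}^na_{ij}e_j\in K'\otimes_KE$, and for $A=\{i_1<\dots<i_k\}$ let $f_A=f_{i_1}\wedge\dots\wedge f_{i_k}$ with image $\bar f_A$ in $K'\{\Delta\}$. For sets of equal size let $A<_{\mathrm{lex}}B$ iff $\min((A\setminus B)\cup(B\setminus A))\in A$. The exterior shifting of $\Delta$ is the simplicial complex $$\Delta^e=\bigcup_{i=0}^{\dim\Delta+1}\Big\{A\subseteq[n]:|A|=i,\ \bar f_A\notin\operatorname{span}_{K'}\{\bar f_{A'}:|A'|=i,\ A'<_{\mathrm{lex}}A\}\Big\}.$$ It satisfies $J_{\Delta^e}=\operatorname{gin}_{<_{\mathrm{rlex}}}(J_\Delta)$. *)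

(* Defs.v *)
From HB Require Import structures.
From mathcomp Require Import all_boot all_order all_algebra all_field.
From mathcomp Require Import boolp.
From mathcomp Require Import mpoly.

Set Implicit Arguments.
Unset Strict Implicit.
Unset Printing Implicit Defensive.

Import GRing.Theory.
Local Open Scope ring_scope.

(* [x : exterior K n] is given by its coordinates: [x A] is the coefficient of
   e_A.  The product is e_A * e_B = (-1)^(inversions A B) e_(A :|: B) when A
   and B are disjoint, and 0 otherwise. The n generators are numbered from 0. *)
Definition exterior (K : fieldType) (n : nat) : Type :=
  {ffun {set 'I_n} -> K^o}.

HB.instance Definition _ (K : fieldType) (n : nat) :=
  Vector.copy (exterior K n) {ffun {set 'I_n} -> K^o}.

Section ExteriorAlgebra.
Variables (K : fieldType) (n : nat).
Local Notation E := (exterior K n).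
Implicit Types (A B C D : {set 'I_n}) (x y z : E).

Definition inversions A B : nat :=
  (\sum_(a in A) #|[set b in B | (b < a)%N]|)%N.

Definition ext_sign A B : K := (-1) ^+ inversions A B.

Definition emon A : E := [ffun B => (B == A)%:R].

Definition ext_one : E := emon set0.

Definition ext_mul x y : E :=
  [ffun C : {set 'I_n} => \sum_(A : {set 'I_n} | A \subset C)
               ext_sign A (C :\: A) * x A * y (C :\: A)].

Lemma inversions0l A : inversions set0 A = 0%N.
Proof. by rewrite /inversions big_set0. Qed.

Lemma inversions0r A : inversions A set0 = 0%N.
Proof.
rewrite /inversions big1 // => a _; apply: eq_card0 => b.
by rewrite !inE.
Qed.

Lemma inversionsUl A B C : [disjoint A & B] ->
  inversions (A :|: B) C = (inversions A C + inversions B C)%N.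
Proof. by move=> dAB; rewrite /inversions -bigU //=; apply: eq_bigl => a; rewrite !inE. Qed.

Lemma inversionsUr A B C : [disjoint B & C] ->
  inversions A (B :|: C) = (inversions A B + inversions A C)%N.
Proof.
move=> dBC; rewrite /inversions -big_split /=; apply: eq_bigr => a _.
have -> : [set b in B :|: C | (b < a)%N] =
          [set b in B | (b < a)%N] :|: [set b in C | (b < a)%N].
  by apply/setP => b; rewrite !inE andb_orl.
rewrite cardsU (_ : _ :&: _ = set0) ?cards0 ?subn0 //.
apply/setP => b; rewrite !inE; apply/negbTE/negP => /andP[/andP[bB _]].
by move=> /andP[bC _]; rewrite (disjointFr dBC bB) in bC.
Qed.

Lemma ext_mulA : associative ext_mul.
Proof.
move=> x y z; apply/ffunP => D; rewrite !ffunE.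
under eq_bigr => A AD do rewrite ffunE big_distrr /=.
under [RHS]eq_bigr => C CD do rewrite ffunE big_distrr big_distrl /=.
rewrite [RHS](exchange_big_dep (fun A : {set 'I_n} => A \subset D)) /=; last first.
  by move=> C A CD AC; apply: subset_trans CD.
apply: eq_bigr => A AD.
rewrite [RHS](reindex_onto (fun B => A :|: B) (fun C => C :\: A)) /=; last first.
  move=> C /andP[_ AC]; apply/setP => i; rewrite !inE.
  by case: (boolP (i \in A)) => //= /(subsetP AC).
apply: eq_big => [B|B].
  rewrite subUset AD subsetUl andbT /= subsetD.
  by rewrite setDUl setDv set0U (sameP eqP setDidPl).
rewrite subsetD => /andP[BD dBA].
have dAB : [disjoint A & B] by rewrite disjoint_sym.
have eB : (A :|: B) :\: A = B.
  by rewrite setDUl setDv set0U; apply/setDidPl.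
have eD : D :\: A = B :|: (D :\: (A :|: B)).
  apply/setP => i; rewrite !inE negb_or.
  case: (boolP (i \in B)) => [iB|_] /=; last by rewrite andbT.
  by rewrite (disjointFr dBA iB) (subsetP BD).
have dBC : [disjoint B & D :\: (A :|: B)].
  by rewrite disjoints_subset; apply/subsetP => i iB; rewrite !inE iB orbT.
have eDB : D :\: A :\: B = D :\: (A :|: B) by rewrite setDDl.
rewrite eB eDB {1}eD /ext_sign inversionsUr // inversionsUl // !exprD.
rewrite -!mulrA [LHS]mulrCA; congr (_ * _).
by rewrite [x A * _]mulrCA [LHS]mulrCA.
Qed.

Lemma emon_id A : emon A A = 1.
Proof. by rewrite ffunE eqxx. Qed.

Lemma ext_mul1l : left_id ext_one ext_mul.
Proof.
move=> x; apply/ffunP => C; rewrite ffunE (bigD1 set0) ?sub0set //=.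
rewrite emon_id setD0 /ext_sign inversions0l !mul1r big1 ?addr0 //.
by move=> A /andP[_ /negbTE A0]; rewrite ffunE A0 mulr0 mul0r.
Qed.

Lemma ext_mul1r : right_id ext_one ext_mul.
Proof.
move=> x; apply/ffunP => C; rewrite ffunE (bigD1 C) ?subxx //=.
rewrite setDv emon_id /ext_sign inversions0r mul1r mulr1 big1 ?addr0 //.
move=> A /andP[AC nAC]; rewrite ffunE setD_eq0.
by rewrite eqEsubset AC /= in nAC; rewrite (negbTE nAC) mulr0.
Qed.

Lemma ext_mulDl : left_distributive ext_mul +%R.
Proof.
move=> x y z; apply/ffunP => C; rewrite !ffunE -big_split /=.
by apply: eq_bigr => A _; rewrite ffunE mulrDr mulrDl.
Qed.

Lemma ext_mulDr : right_distributive ext_mul +%R.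
Proof.
move=> x y z; apply/ffunP => C; rewrite !ffunE -big_split /=.
by apply: eq_bigr => A _; rewrite ffunE mulrDr.
Qed.

Lemma ext_one_neq0 : ext_one != 0.
Proof.
apply/eqP => /ffunP/(_ set0); rewrite emon_id ffunE => /eqP.
by rewrite oner_eq0.
Qed.

HB.instance Definition _ := GRing.Zmodule_isNzRing.Build E
  ext_mulA ext_mul1l ext_mul1r ext_mulDl ext_mulDr ext_one_neq0.

Lemma ext_scalerAl (c : K) x y : c *: (x * y) = (c *: x) * y.
Proof.
apply/ffunP => C; rewrite !ffunE scaler_sumr.
by apply: eq_bigr => A _; rewrite ffunE /GRing.scale /= !mulrA; congr (_ * _ * _);
   rewrite mulrC.
Qed.

HB.instance Definition _ := GRing.Lmodule_isLalgebra.Build K E ext_scalerAl.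

Lemma ext_scalerAr (c : K) x y : c *: (x * y) = x * (c *: y).
Proof.
apply/ffunP => C; rewrite !ffunE scaler_sumr.
by apply: eq_bigr => A _; rewrite ffunE /GRing.scale /= mulrCA.
Qed.

HB.instance Definition _ := GRing.Lalgebra_isAlgebra.Build K E ext_scalerAr.
HB.instance Definition _ := Algebra_isFalgebra.Build K E.

Definition egen (i : 'I_n) : E := emon [set i].

(* f_A = f_{i_1} * ... * f_{i_r} for A = {i_1 < ... < i_r} *)
Definition wedge (f : 'I_n -> E) (A : {set 'I_n}) : E :=
  \prod_(i <- enum A) f i.

Definition linear_forms (a : 'M[K]_n) (i : 'I_n) : E :=
  \sum_(j < n) a i j *: egen j.

(* the graded component of degree j; it is 0 when j < 0 *)
Definition ext_deg (j : int) : {vspace E} :=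
  (\sum_(A : {set 'I_n} | #|A|%:Z == j) <[emon A]>)%VS.

Definition ext_ideal (U : {vspace E}) : {vspace E} := (fullv * U * fullv)%VS.

Definition face_ideal (Delta : {set {set 'I_n}}) : {vspace E} :=
  ext_ideal (\sum_(F : {set 'I_n} | F \notin Delta) <[emon F]>)%VS.

(* H^j(E/I, v) for an ideal I is the quotient of [cocycles I v j] by
   [coboundaries I v j], the inverse images in E_j of the kernel of
   (E/I)_j -> (E/I)_(j+1) and of the image of (E/I)_(j-1) -> (E/I)_j.  The
   former contains the latter when v has degree 1, since then v * v = 0. *)
Definition cocycles (I : {vspace E}) (v : E) (j : int) : {vspace E} :=
  (ext_deg j :&: (amulr v @^-1: I))%VS.

Definition coboundaries (I : {vspace E}) (v : E) (j : int) : {vspace E} :=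
  ((amulr v @: ext_deg (j - 1)) + (ext_deg j :&: I))%VS.

Definition dim_cohomology (I : {vspace E}) (v : E) (j : int) : nat :=
  (\dim (cocycles I v j) - \dim (coboundaries I v j))%N.

(* alpha_{i+1,j}(v; E/J): the index i starts at 0 *)
Definition annihilator_number (v : 'I_n -> E) (J : {vspace E})
    (i : 'I_n) (j : int) : nat :=
  dim_cohomology
    (J + ext_ideal (\sum_(k < n | (k < i)%N) <[v k]>))%VS (v i) j.

(* For sets of the same size this is both A <_lex B and e_A <_rlex e_B. *)
Definition lexlt A B : bool :=
  [exists i in A :\: B, [forall k in (A :\: B) :|: (B :\: A), (i <= k)%N]].

Definition initial_monomial x A : Prop :=
  x A != 0 /\ forall B, x B != 0 -> B != A -> lexlt B A.

(* Intended for graded ideals I. *)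
Definition initial_ideal (I : {vspace E}) : {vspace E} :=
  ext_ideal (\sum_(A : {set 'I_n} |
    `[< exists (j : int) (x : E),
          [/\ x \in I, x \in ext_deg j & initial_monomial x A] >])
    <[emon A]>)%VS.

(* the algebra endomorphism of E sending e_i to \sum_j phi i j *: e_j *)
Definition ext_subst (phi : 'M[K]_n) (x : E) : E :=
  \sum_(A : {set 'I_n}) (x A : K) *: wedge (linear_forms phi) A.

Lemma ext_subst_is_linear phi : linear (ext_subst phi).
Proof.
move=> c x y; rewrite /ext_subst scaler_sumr -big_split /=.
by apply: eq_bigr => A _; rewrite !ffunE scalerDl scalerA.
Qed.

HB.instance Definition _ phi :=
  GRing.isLinear.Build K E E _ (ext_subst phi) (ext_subst_is_linear phi).

(* open subsets of GL_n(K), seen inside the affine space of n x n matrices *)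
Definition zariski_open_GL (U : 'M[K]_n -> Prop) : Prop :=
  exists S : {mpoly K[n * n]} -> Prop, forall phi : 'M[K]_n,
    U phi <-> phi \in unitmx /\
              exists2 p, S p & p.@[fun k => mxvec phi 0 k] != 0.

Definition is_gin (J G : {vspace E}) : Prop :=
  exists U : 'M[K]_n -> Prop,
    [/\ zariski_open_GL U, exists phi, U phi &
        forall phi, U phi -> initial_ideal (linfun (ext_subst phi) @: J)%VS = G].

(* The value 0 is a default for the (impossible) case of no generic value. *)
Definition gin (J : {vspace E}) : {vspace E} :=
  if pselect (exists G, is_gin J G) is left exG then sval (cid exG) else 0%VS.

Definition generic_annihilator_number (J : {vspace E}) : 'I_n -> int -> nat :=
  annihilator_number egen (gin J).

(* The class of f_A in E/J_Delta lies in the span of the classes of the f_A'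
   iff f_A lies in the span of the f_A' plus J_Delta.  Here [K] plays the role of
   the extension field containing the generic coefficients [a]. *)
Definition exterior_shifting (a : 'M[K]_n) (Delta : {set {set 'I_n}}) :
    {set {set 'I_n}} :=
  let f := linear_forms a in
  [set A : {set 'I_n} |
    (#|A| <= \max_(F in Delta) #|F|)%N &&
    (wedge f A \notin
       (\sum_(A' : {set 'I_n} | (#|A'| == #|A|) && lexlt A' A) <[wedge f A']>
        + face_ideal Delta)%VS)].

Lemma emonM A B : emon A * emon B =
  if [disjoint A & B] then ext_sign A B *: emon (A :|: B) else 0.
Proof.
apply/ffunP => C; rewrite ffunE.
have [AC|nAC] := boolP (A \subset C); last first.
  rewrite big1 => [|D DC]; last first.
    by rewrite ffunE; case: eqP DC nAC => [-> ->|]; rewrite // mulr0 mul0r.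
  case: ifP => _; rewrite !ffunE //; case: eqP nAC => [->|_ _].
    by rewrite subsetUl.
  by rewrite scaler0.
rewrite (bigD1 A) //= emon_id mulr1 big1 ?addr0; last first.
  by move=> D /andP[_ /negbTE DA]; rewrite ffunE DA mulr0 mul0r.
rewrite ffunE; case: eqP => [eB|nB].
  rewrite -eB disjoint_sym disjoints_subset subsetDr !ffunE.
  by rewrite setDE setUIr setUCr setIT (setUidPr AC) eqxx.
case: ifP => dAB; rewrite !ffunE mulr0 //.
case: eqP => [eC|_]; last by rewrite scaler0.
case: nB; rewrite eC setDUl setDv set0U; apply/setDidPl.
by rewrite disjoint_sym.
Qed.

Lemma egen_sq i : egen i * egen i = 0.
Proof. by rewrite emonM disjoints1 inE eqxx. Qed.

Lemma egen_anticomm i j : egen i * egen j = - (egen j * egen i).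
Proof.
have [->|nij] := eqVneq i j; first by rewrite egen_sq oppr0.
rewrite !emonM !disjoints1 !inE [j == i]eq_sym (negbTE nij) /= setUC.
rewrite -scaleNr; congr (_ *: _); rewrite /ext_sign /inversions !big_set1.
have card1 (k l : 'I_n) : #|[set b in [set k] | (b < l)%N]| = (k < l)%N.
  case: ltnP => kl; first by rewrite (_ : finset _ = [set k]) ?cards1 //;
    apply/setP => b; rewrite !inE; case: eqP => // ->.
  rewrite (_ : finset _ = set0) ?cards0 //; apply/setP => b; rewrite !inE.
  by case: eqP => // ->; rewrite ltnNge kl.
rewrite !card1; case: ltngtP => [||/val_inj/eqP]; rewrite ?(negbTE nij) //=.
  by rewrite expr0 expr1 opprK.
by rewrite eq_sym (negbTE nij).
Qed.

Lemma emonE A : emon A = wedge egen A.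
Proof.
have prodE (s : seq 'I_n) : sorted (relpre val ltn) s ->
    \prod_(i <- s) egen i = emon [set i in s].
  elim: s => [|i s IHs] si.
    by rewrite big_nil -[1]/ext_one; congr emon; apply/setP => k; rewrite !inE.
  rewrite big_cons IHs; last exact: path_sorted si.
  have /allP lti : all (fun k : 'I_n => (i < k)%N) s.
    by apply: order_path_min si => x y z; apply: ltn_trans.
  rewrite emonM disjoints1 inE; case: ifPn => [_|]; last first.
    by rewrite negbK => /lti; rewrite ltnn.
  rewrite /ext_sign /inversions big_set1 (_ : #|_| = 0%N).
    by rewrite scale1r; congr emon; apply/setP => k; rewrite !inE.
  apply: eq_card0 => k; rewrite !inE; apply/negP => /andP[/lti ik ki].
  by have := ltn_trans ik ki; rewrite ltnn.
rewrite /wedge prodE; first by congr emon; apply/setP => k; rewrite inE mem_enum.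
rewrite /enum_mem sorted_filter //; first by move=> x y z; apply: ltn_trans.
by rewrite -enumT -sorted_map val_enum_ord iota_ltn_sorted.
Qed.

End ExteriorAlgebra.

(* every i in [n] is required to be a vertex *)
Definition simplicial_complex (n : nat) (Delta : {set {set 'I_n}}) : Prop :=
  (forall i, [set i] \in Delta) /\
  (forall F G : {set 'I_n}, G \in Delta -> F \subset G -> F \in Delta).

Definition infinite_field (K : fieldType) : Prop :=
  forall s : seq K, exists x, x \notin s.

(* algebraic independence over K of the n * n entries of a *)
Definition alg_independent (K K' : fieldType) (iota : {rmorphism K -> K'})
    (n : nat) (a : 'M[K']_n) : Prop :=
  forall p : {mpoly K[n * n]}, mmap iota (fun k => mxvec a 0 k) p = 0 -> p = 0.

(* Main.v *)
(* A face ideal is spanned by monomials, so the cohomology of right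
   multiplication by e_i on a quotient by a monomial ideal can be read off from
   the monomials: a basis of H^j consists of the faces F of size j that avoid
   [i] and cannot be extended by i.  It remains to identify gin (J_Delta) with
   the face ideal of Delta^e.  If b is the inverse of phi, then e_A is an initial
   monomial of phi (J) iff e_A lies in the span of the smaller e_B plus phi (J);
   applying phi^-1, this says that the wedge of b at A lies in the span of the
   smaller wedges plus J, i.e. that A is not in the shifting of Delta computed
   with b.  Membership in the shifting is an equality of ranks of matrices with
   polynomial entries in b, so for b outside the zero set of a nonzero polynomial
   it agrees with the membership computed at the generic matrix a. *)
Require Import Defs.
From HB Require Import structures.
From mathcomp Require Import all_boot all_order all_algebra all_field.
From mathcomp Require Import boolp.
From mathcomp Require Import mpoly.

Set Implicit Arguments.
Unset Strict Implicit.
Unset Printing Implicit Defensive.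

Import GRing.Theory.
Local Open Scope ring_scope.

(** * Monomial ideals and their annihilator numbers *)

Section MonomialSpaces.
Variables (K : fieldType) (n : nat).
Local Notation E := (exterior K n).
Implicit Types (A B C F : {set 'I_n}) (P Q : pred {set 'I_n}) (x y : E).

Lemma ext_decomp x : x = \sum_A (x A : K) *: emon K A.
Proof.
apply/ffunP => B; rewrite sum_ffunE (bigD1 B) //= !ffunE eqxx /GRing.scale /=.
rewrite mulr1 big1 ?addr0 // => A /negbTE nAB.
by rewrite !ffunE eq_sym nAB /GRing.scale /= mulr0.
Qed.

Lemma ext_mul_neq0 x y C : (x * y) C != 0 ->
  exists A, [/\ A \subset C, x A != 0 & y (C :\: A) != 0].
Proof.
rewrite ffunE => nz.
have /existsP[A /and3P[sAC xA yA]] :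
  [exists A : {set 'I_n}, [&& A \subset C, x A != 0 & y (C :\: A) != 0]].
  apply: contraNT nz => /existsPn xy0.
  rewrite big1 // => A sAC; have := xy0 A; rewrite sAC /= negb_and !negbK.
  by case/orP => /eqP ->; rewrite ?mulr0 ?mul0r.
by exists A.
Qed.

Definition monomial_space P : {vspace E} := (\sum_(A | P A) <[emon K A]>)%VS.

Lemma memv_monomial P A : P A -> emon K A \in monomial_space P.
Proof. by move=> PA; apply: (subvP (sumv_sup A PA (subvv _))); apply: memv_line. Qed.

(** Since the monomials form a basis, sums, intersections and inclusions of monomial subspaces
    become statements about sets. *)
Lemma monomial_spaceP P x :
  reflect (forall A, x A != 0 -> P A) (x \in monomial_space P).
Proof.
apply: (iffP memv_sumP) => [[v vP ->] A|Px].
  apply: contraNT => nPA; rewrite sum_ffunE big1 // => B PB.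
  have /vlineP[c ->] := vP B PB; rewrite !ffunE; case: eqP => [AB|_].
    by rewrite AB PB in nPA.
  by rewrite scaler0.
exists (fun A => (x A : K) *: emon K A) => [A _|]; first by rewrite memvZ ?memv_line.
rewrite {1}[x]ext_decomp [LHS](bigID P) /= [X in _ + X]big1 ?addr0 // => A nPA.
have [->|/Px] := eqVneq (x A) 0; first by rewrite scale0r.
by rewrite (negbTE nPA).
Qed.

Lemma eq_monomial_space P Q : P =1 Q -> monomial_space P = monomial_space Q.
Proof. by move=> PQ; apply: eq_bigl. Qed.

Lemma monomial_spaceU P Q :
  (monomial_space P + monomial_space Q)%VS = monomial_space (predU P Q).
Proof.
apply: subv_anti; apply/andP; split.
  rewrite subv_add; apply/andP; split; apply/subvP => x /monomial_spaceP xP;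
  apply/monomial_spaceP => A /xP PA; apply/orP; first by left.
  by right.
apply/subv_sumP => A /orP[] PA; rewrite -memvE.
  exact: (subvP (addvSl _ _) _ (memv_monomial PA)).
exact: (subvP (addvSr _ _) _ (memv_monomial PA)).
Qed.

Lemma monomial_spaceI P Q :
  (monomial_space P :&: monomial_space Q)%VS = monomial_space (predI P Q).
Proof.
apply/vspaceP => x; rewrite memv_cap; apply/andP/monomial_spaceP.
  by case=> /monomial_spaceP xP /monomial_spaceP xQ A xA; apply/andP; split; auto.
by move=> xPQ; split; apply/monomial_spaceP => A /xPQ/andP[].
Qed.

Lemma dim_monomial_space P : \dim (monomial_space P) = #|[set A | P A]|.
Proof.
have emon_neq0 A : emon K A != 0.
  by apply/eqP => /ffunP/(_ A)/eqP; rewrite emon_id ffunE oner_eq0.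
rewrite /monomial_space (directvP _) /=.
  rewrite cardsE -sum1_card; apply: eq_bigr => A _.
  by rewrite dim_vline emon_neq0.
apply/directv_sum_independent => v vP v0 A PA.
have /vlineP[c vA] := vP A PA; rewrite vA.
suff -> : c = 0 by rewrite scale0r.
move/ffunP/(_ A): v0; rewrite sum_ffunE (bigD1 A) //= vA big1.
  by rewrite !ffunE eqxx /GRing.scale /= mulr1 addr0.
move=> B /andP[PB nBA]; have /vlineP[d ->] := vP B PB.
by rewrite !ffunE eq_sym (negbTE nBA) scaler0.
Qed.

(** A coefficient of a product at [C] only involves coefficients of the factors at subsets of [C].
    Conversely, if [A] lies in [B], then [emon B] is up to sign [emon A] times the monomial of the
    complement. *)
Lemma ext_ideal_monomial P :
  ext_ideal (monomial_space P) =
  monomial_space (fun B => [exists A, P A && (A \subset B)]).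
Proof.
apply: subv_anti; apply/andP; split.
  apply/prodvP => u v uP _; apply/monomial_spaceP.
  move=> C /ext_mul_neq0[A [sAC uA _]]; apply/existsP.
  have /subvP/(_ u uP)/monomial_spaceP/(_ A uA)/existsP[B /andP[PB BA]] :
      (fullv * monomial_space P <=
       monomial_space (fun B => [exists A, P A && (A \subset B)]))%VS.
    apply/prodvP => w z _ /monomial_spaceP zP; apply/monomial_spaceP.
    move=> D /ext_mul_neq0[B [BD _ /zP PDB]].
    by apply/existsP; exists (D :\: B); rewrite PDB subsetDl.
  by exists B; rewrite PB (subset_trans BA).
apply/subv_sumP => B /existsP[A /andP[PA AB]]; rewrite -memvE.
have -> : emon K B = (ext_sign K A (B :\: A))^-1 *: (1 * emon K A * emon K (B :\: A)).
  rewrite mul1r emonM disjoint_sym disjoints_subset subsetDr.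
  by rewrite scalerA mulVf ?signr_eq0 // scale1r setDE setUIr setUCr setIT (setUidPr AB).
by rewrite memvZ // !memv_mul ?memvf // memv_monomial.
Qed.
End MonomialSpaces.

(** * Face ideals and the cohomology of their quotients *)

Section FaceIdeals.
Variables (K : fieldType) (n : nat).
Local Notation E := (exterior K n).
Implicit Types (A B F G : {set 'I_n}) (Gamma : {set {set 'I_n}}).

Definition hereditary Gamma : Prop :=
  forall F G, G \in Gamma -> F \subset G -> F \in Gamma.

Lemma face_ideal_monomial Gamma : hereditary Gamma ->
  face_ideal K Gamma = monomial_space K (fun F => F \notin Gamma).
Proof.
move=> hG; rewrite /face_ideal -/(monomial_space _ _) ext_ideal_monomial.
apply: eq_monomial_space => B; apply/existsP/idP => [[A /andP[nA AB]]|nB].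
  by apply: contra nA => /hG; apply.
by exists B; rewrite nB subxx.
Qed.

Lemma ext_degE j : ext_deg K n j = monomial_space K (fun A => #|A|%:Z == j).
Proof. by []. Qed.

Lemma variable_ideal (i : 'I_n) :
  ext_ideal (\sum_(k < n | (k < i)%N) <[egen K k]>)%VS =
  monomial_space K (fun F => [exists k in F, (k < i)%N]).
Proof.
set P : pred {set 'I_n} := fun A => [exists k : 'I_n, (k < i)%N && (A == [set k])].
have -> : (\sum_(k < n | (k < i)%N) <[egen K k]>)%VS = monomial_space K P.
  apply: subv_anti; apply/andP; split; apply/subv_sumP.
    move=> k ki; rewrite -memvE; apply: memv_monomial.
    by apply/existsP; exists k; rewrite ki eqxx.
  move=> A /existsP[k /andP[ki /eqP ->]]; exact: (sumv_sup k).
rewrite ext_ideal_monomial; apply: eq_monomial_space => B.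
apply/existsP/existsP => [[A /andP[/existsP[k /andP[ki /eqP ->]]]]|[k /andP[kB ki]]].
  by rewrite sub1set => kB; exists k; rewrite kB.
exists [set k]; rewrite sub1set kB andbT.
by apply/existsP; exists k; rewrite ki eqxx.
Qed.

Lemma egen_mulr (x : E) i A :
  (x * egen K i) A = if i \in A then ext_sign K (A :\ i) [set i] * x (A :\ i) else 0.
Proof.
rewrite ffunE; case: ifP => iA; last first.
  rewrite big1 // => B BA; rewrite ffunE; case: eqP => [e|]; last by rewrite mulr0.
  by have := set11 i; rewrite -e inE iA andbF.
have e1 : A :\: (A :\ i) = [set i].
  by apply/setP => k; rewrite !inE; case: (eqVneq k i) => [->|] //=; rewrite andNb.
rewrite (bigD1 (A :\ i)) ?subD1set //= e1 emon_id mulr1 big1 ?addr0 //.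
move=> B /andP[BA nB]; rewrite ffunE; case: eqP => [e|]; last by rewrite mulr0.
case/eqP: nB; rewrite -e; apply/setP => k; rewrite !inE.
case: (boolP (k \in B)) => /= [/(subsetP BA) ->//|_].
by case: (k \in A).
Qed.

(** Cocycles and coboundaries are both spanned by monomials of degree [j]. Outside the ideal,
    cocycles contribute the sets that contain [i] or leave the complex when [i] is added, and
    coboundaries only those that contain [i]. *)
Lemma annihilator_number_face_ideal Gamma (i : 'I_n) (j : int) :
  hereditary Gamma ->
  annihilator_number (egen K (n := n)) (face_ideal K Gamma) i j =
  #|[set F in Gamma |
      [&& #|F|%:Z == j, [set k : 'I_n | (k <= i)%N] :&: F == set0 &
          F :|: [set i] \notin Gamma]]|.
Proof.
move=> hG; rewrite /annihilator_number variable_ideal face_ideal_monomial //.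
rewrite monomial_spaceU /dim_cohomology.
set Q := predU _ _.
(* [Q] describes the monomials in the ideal. Being closed upwards, it makes coboundaries a subspace
   of cocycles, so that the difference of dimensions counts a set difference. *)
have hQ A B : Q A -> A \subset B -> Q B.
  move=> /orP[nA AB|/existsP[k /andP[kA ki]] AB]; apply/orP.
    by left; apply: contra nA => /hG; apply.
  by right; apply/existsP; exists k; rewrite (subsetP AB) // ki.
have -> : cocycles (monomial_space K Q) (egen K i) j = monomial_space K
    (fun A => (#|A|%:Z == j) && ((i \in A) || Q (i |: A))).
  apply/vspaceP => x; rewrite memv_cap -memv_preim lfunE /= ext_degE.
  apply/andP/monomial_spaceP => [[/monomial_spaceP xj /monomial_spaceP xQ] A xA|xP].
    rewrite (xj A xA); case: (boolP (i \in A)) => //= iA; apply: xQ.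
    by rewrite egen_mulr setU11 setU1K // mulf_neq0 // signr_eq0.
  split; apply/monomial_spaceP => A; first by move/xP/andP => [].
  rewrite egen_mulr; case: ifP => iA; last by rewrite eqxx.
  rewrite mulf_eq0 signr_eq0 /= => /xP /andP[_].
  by rewrite !inE eqxx /= setD1K.
have -> : coboundaries (monomial_space K Q) (egen K i) j = monomial_space K
    (fun A => (#|A|%:Z == j) && ((i \in A) || Q A)).
  rewrite /coboundaries !ext_degE monomial_spaceI.
  have -> : (amulr (egen K i) @: monomial_space K (fun A => #|A|%:Z == (j - 1)))%VS =
      monomial_space K (fun A => (#|A|%:Z == j) && (i \in A)).
    apply: subv_anti; apply/andP; split.
      apply/subvP => x.
      case/memv_imgP => y /monomial_spaceP yP ->; rewrite lfunE /=.
      apply/monomial_spaceP => A; rewrite egen_mulr.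
      case: ifP => iA; last by rewrite eqxx.
      rewrite mulf_eq0 signr_eq0 /= => /yP; rewrite (cardsD1 i A) iA andbT.
      by rewrite -(inj_eq (addIr 1)) subrK addrC.
    apply/subv_sumP => A /andP[/eqP Aj iA]; rewrite -memvE.
    have -> : emon K A = (ext_sign K (A :\ i) [set i])^-1 *:
                         amulr (egen K i) (emon K (A :\ i)).
      rewrite lfunE /= emonM disjoint_sym disjoints1 !inE eqxx /= setUC setD1K //.
      by rewrite scalerA mulVf ?signr_eq0 // scale1r.
    apply/memvZ/memv_img/memv_monomial.
    by rewrite -Aj (cardsD1 i A) iA add1n intS addrC addKr.
  rewrite monomial_spaceU; apply: eq_monomial_space => A /=.
  by rewrite -andb_orr.
rewrite !dim_monomial_space -cardsDS; last first.
  apply/subsetP => A; rewrite !inE => /andP[-> /=]; case: (i \in A) => //= QA.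
  by apply: (hQ A); rewrite ?subsetUr.
apply: eq_card => A; rewrite !inE.
(* The variables before [i] are killed by the ideal, while [i] itself is excluded by the
   coboundaries; together they give the condition on $[i]$. *)
have -> : ([set k : 'I_n | (k <= i)%N] :&: A == set0) =
          (i \notin A) && ~~ [exists k in A, (k < i)%N].
  apply/eqP/andP => [e|[iA /exists_inPn lA]].
    split; last apply/exists_inPn => k kA.
      by apply/negP => iA; have := in_set0 i; rewrite -e !inE leqnn iA.
    by apply/negP => ki; have := in_set0 k; rewrite -e !inE kA (ltnW ki).
  apply/setP => k; rewrite !inE leq_eqVlt; apply/negP => /andP[/orP[/eqP/val_inj e|ki] kA].
    by rewrite -e kA in iA.
  by have := lA k kA; rewrite ki.
rewrite [A :|: _]setUC /Q /=.
have -> : [exists k in i |: A, (k < i)%N] = [exists k in A, (k < i)%N].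
  apply/exists_inP/exists_inP => [[k]|[k kA ki]]; last by exists k; rewrite ?inE ?kA ?orbT.
  by rewrite !inE => /orP[/eqP ->|kA ki]; [rewrite ltnn|exists k].
by case: (A \in Gamma); case: (i \in A); case: (_ == j); case: [exists k in A, _];
   rewrite //= ?orbF ?orbT ?andbF ?andbT.
Qed.
End FaceIdeals.

(** * Products of linear forms and substitutions *)

(** Adjoining a new minimum to [B] multiplies the ordered product [wedge f B] on the left by one
    factor, so this induction follows the product. *)
Lemma set_min_ind n (P : {set 'I_n} -> Prop) : P set0 ->
  (forall (i : 'I_n) (B : {set 'I_n}), (forall k, k \in B -> (i < k)%N) -> P B -> P (i |: B)) ->
  forall B, P B.
Proof.
move=> P0 PU B; have [m] := ubnP #|B|; elim: m B => // m IHm B lBm.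
have [->//|/set0Pn[b0 b0B]] := eqVneq B set0.
case: (arg_minnP (fun k : 'I_n => k : nat) b0B) => b bB minb.
have {}bB : b \in B := bB.
rewrite -(setD1K bB); apply: PU => [k|].
  rewrite !inE => /andP[kb kB]; rewrite ltn_neqAle minb // andbT.
  by rewrite eq_sym.
by apply: IHm; rewrite (cardsD1 b) bB in lBm.
Qed.

Lemma enum_setU1_min n (i : 'I_n) (B : {set 'I_n}) :
  (forall k, k \in B -> (i < k)%N) -> enum (i |: B) = i :: enum B.
Proof.
move=> lti; have ltT : transitive (relpre (val : 'I_n -> nat) ltn).
  by move=> x y z; apply: ltn_trans.
have sortE (A : {set 'I_n}) : sorted (relpre val ltn) (enum A).
  rewrite /enum_mem sorted_filter // -enumT.
  by rewrite -sorted_map val_enum_ord iota_ltn_sorted.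
apply: (irr_sorted_eq ltT) => //.
- by move=> x; rewrite /= ltnn.
- rewrite /= (path_sortedE ltT) sortE andbT; apply/allP => k.
  by rewrite mem_enum; apply: lti.
- by move=> k; rewrite inE !mem_enum !inE.
Qed.

Section WedgeProducts.
Variables (K : fieldType) (n : nat).
Local Notation E := (exterior K n).
Implicit Types (A B C D F : {set 'I_n}) (x y : E) (f : 'I_n -> E) (i j k : 'I_n).

Lemma wedge0 f : wedge f set0 = 1.
Proof. by rewrite /wedge enum_set0 big_nil. Qed.

Lemma wedgeU1_min f i B : (forall k, k \in B -> (i < k)%N) ->
  wedge f (i |: B) = f i * wedge f B.
Proof. by move=> lti; rewrite /wedge enum_setU1_min // big_cons. Qed.

Lemma ext_sign1_min i B : (forall k, k \in B -> (i < k)%N) ->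
  ext_sign K [set i] B = 1.
Proof.
move=> lti; rewrite /ext_sign /inversions big_set1 eq_card0 // => k.
rewrite !inE; apply/negP => /andP[/lti ik ki].
by have := ltn_trans ik ki; rewrite ltnn.
Qed.

(** The squares are listed separately because anticommutation does not force them to vanish in
    characteristic 2. *)
Definition anticommuting f : Prop :=
  (forall i, f i * f i = 0) /\ (forall i j, f i * f j = - (f j * f i)).

(** The factor [f i] moves right past each smaller index at the cost of one sign, until it reaches
    its place or meets its equal. *)
Lemma wedge1M f i B : anticommuting f ->
  f i * wedge f B =
  if i \in B then 0 else ext_sign K [set i] B *: wedge f (i |: B).
Proof.
case=> f2 fC; elim/set_min_ind: B => [|b B ltb IHB].
  rewrite inE ext_sign1_min => [|k]; last by rewrite inE.
  by rewrite wedgeU1_min ?scale1r // => k; rewrite inE.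
have bB : b \notin B by apply/negP => /ltb; rewrite ltnn.
have [ib|bi|/val_inj ->] := ltngtP i b.
- have lti k : k \in b |: B -> (i < k)%N.
    by rewrite !inE => /orP[/eqP ->//|/ltb]; apply: ltn_trans.
  rewrite ext_sign1_min // scale1r (wedgeU1_min f lti).
  by case: ifP => // /lti; rewrite ltnn.
- rewrite wedgeU1_min // mulrA fC mulNr -mulrA IHB !inE.
  have -> /= : (i == b) = false by apply/eqP => e; rewrite e ltnn in bi.
  case: ifP => iB; first by rewrite mulr0 oppr0.
  have ltb' k : k \in i |: B -> (b < k)%N by rewrite !inE => /orP[/eqP ->|/ltb].
  rewrite -scalerAr -wedgeU1_min // -scaleNr setUCA; congr (_ *: _).
  rewrite /ext_sign inversionsUr ?disjoints1 // exprD.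
  suff -> : inversions [set i] [set b] = 1%N by rewrite expr1 mulN1r.
  rewrite /inversions big_set1 (_ : finset _ = [set b]) ?cards1 //.
  by apply/setP => k; rewrite !inE; case: eqP => // ->.
- by rewrite wedgeU1_min // mulrA f2 mul0r !inE eqxx.
Qed.

(** This is the rule [emonM] with the same signs. In the induction the new minimum [i] has no
    inversions with [A], so only those with [B] are added. *)
Lemma wedgeM f A B : anticommuting f ->
  wedge f A * wedge f B =
  if [disjoint A & B] then ext_sign K A B *: wedge f (A :|: B) else 0.
Proof.
move=> fP; elim/set_min_ind: A => [|i A lti IHA].
  rewrite wedge0 mul1r disjoints_subset sub0set set0U.
  by rewrite /ext_sign inversions0l scale1r.
have iA : i \notin A by apply/negP => /lti; rewrite ltnn.
have -> : [disjoint i |: A & B] = [disjoint A & B] && (i \notin B).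
  by rewrite !disjoints_subset subUset sub1set inE andbC.
rewrite wedgeU1_min // -mulrA IHA.
case: ifP => dAB /=; last by rewrite mulr0.
rewrite -scalerAr wedge1M // !inE (negbTE iA) /=.
case: ifP => iB; first by rewrite scaler0.
rewrite scalerA setUA; congr (_ *: _).
rewrite /ext_sign inversionsUr // inversionsUl ?disjoints1 // !exprD.
by rewrite -![(-1) ^+ inversions _ _]/(ext_sign K _ _) ext_sign1_min // mul1r mulrC.
Qed.

Lemma wedge_degree (a : 'M[K]_n) A F :
  wedge (linear_forms a) A F != 0 -> #|F| = #|A|.
Proof.
rewrite /wedge [RHS]cardE; elim: (enum A) F => [|i s IHs] F.
  by rewrite big_nil ffunE; case: (F =P set0) => [->|]; rewrite ?cards0 ?eqxx.
rewrite big_cons => /ext_mul_neq0[B [BF nzB /IHs] /=].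
have -> : #|F| = (#|B| + #|F :\: B|)%N by rewrite -(cardsID B F) (setIidPr BF).
move=> ->; suff -> : #|B| = 1%N by [].
apply/eqP; apply: contraNT nzB => nB; rewrite sum_ffunE big1 // => k _.
rewrite !ffunE; case: eqP => [e|_]; last by rewrite scaler0.
by rewrite e cards1 in nB.
Qed.

Lemma linear_formsC (u v : 'I_n -> K) :
  (\sum_j u j *: egen K j) * (\sum_j v j *: egen K j) =
  - ((\sum_j v j *: egen K j) * (\sum_j u j *: egen K j)).
Proof.
rewrite !mulr_suml -sumrN.
under [LHS]eq_bigr => i _ do rewrite mulr_sumr.
under [RHS]eq_bigr => i _ do rewrite mulr_sumr -sumrN.
rewrite exchange_big; apply: eq_bigr => i _; apply: eq_bigr => j _.
rewrite -!scalerAl -!scalerAr -scalerN -scalerN -egen_anticomm !scalerA.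
by rewrite mulrC.
Qed.

(** Diagonal terms vanish and cross terms cancel in pairs, an argument valid also in characteristic
    2, where [linear_formsC] does not suffice. *)
Lemma linear_form_sq (u : 'I_n -> K) :
  (\sum_j u j *: egen K j) * (\sum_j u j *: egen K j) = 0.
Proof.
elim: (index_enum _) => [|i s IHs]; first by rewrite big_nil mul0r.
rewrite big_cons mulrDl !mulrDr IHs addr0.
have -> : (u i *: egen K i) * (u i *: egen K i) = 0.
  by rewrite -scalerAl -scalerAr egen_sq !scaler0.
rewrite add0r mulr_sumr mulr_suml -big_split big1 //= => j _.
by rewrite -!scalerAl -!scalerAr !scalerA egen_anticomm mulrC scalerN addNr.
Qed.

Lemma linear_forms_anticommuting (a : 'M[K]_n) : anticommuting (linear_forms a).
Proof. by split=> *; [apply: linear_form_sq | apply: linear_formsC]. Qed.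

Lemma wedgeZ (c : K) f A :
  wedge (fun i => c *: f i) A = c ^+ #|A| *: wedge f A.
Proof.
rewrite /wedge cardE; elim: (enum A) => [|i s IHs].
  by rewrite !big_nil scale1r.
by rewrite !big_cons IHs -scalerAl -scalerAr scalerA exprS.
Qed.

Lemma ext_substE (b : 'M[K]_n) A : ext_subst b (emon K A) = wedge (linear_forms b) A.
Proof.
rewrite /ext_subst (bigD1 A) //= emon_id scale1r big1 ?addr0 // => B /negbTE nBA.
by rewrite ffunE nBA scale0r.
Qed.

(** By bilinearity it suffices to treat monomials, on which [emonM] and [wedgeM] are the same
    rule. *)
Lemma ext_substM (b : 'M[K]_n) x y : ext_subst b (x * y) = ext_subst b x * ext_subst b y.
Proof.
rewrite [x]ext_decomp [y]ext_decomp mulr_suml !linear_sum mulr_suml /=.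
apply: eq_bigr => A _; rewrite mulr_sumr linear_sum mulr_sumr /=.
apply: eq_bigr => B _.
rewrite -!scalerAl -!scalerAr !linearZ /= -!scalerAl -!scalerAr; congr (_ *: (_ *: _)).
rewrite emonM !ext_substE wedgeM; last exact: linear_forms_anticommuting.
by case: ifP => _; rewrite ?linear0 // linearZ /= ext_substE.
Qed.

Lemma ext_subst_wedge (b : 'M[K]_n) f A :
  ext_subst b (wedge f A) = wedge (fun i => ext_subst b (f i)) A.
Proof.
rewrite /wedge; elim: (enum A) => [|i s IHs].
  by rewrite !big_nil -[X in ext_subst _ X]/(emon K set0) ext_substE wedge0.
by rewrite !big_cons ext_substM IHs.
Qed.

Lemma ext_subst_linear_forms (b phi : 'M[K]_n) i :
  ext_subst b (linear_forms phi i) = linear_forms (phi *m b) i.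
Proof.
rewrite {1}/linear_forms linear_sum /linear_forms.
transitivity (\sum_j \sum_k (phi i j * b j k) *: egen K k).
  apply: eq_bigr => j _; rewrite linearZ /= /egen ext_substE /wedge enum_set1.
  rewrite big_seq1 /linear_forms scaler_sumr.
  by apply: eq_bigr => k _; rewrite scalerA.
rewrite exchange_big; apply: eq_bigr => k _.
by rewrite mxE scaler_suml.
Qed.

Lemma linear_forms1 i : linear_forms (1%:M : 'M[K]_n) i = egen K i.
Proof.
rewrite /linear_forms (bigD1 i) //= mxE eqxx scale1r big1 ?addr0 // => j.
by rewrite mxE eq_sym => /negbTE ->; rewrite scale0r.
Qed.

Lemma ext_substK (b phi : 'M[K]_n) : phi *m b = 1%:M ->
  cancel (ext_subst phi) (ext_subst b).
Proof.
move=> phib x; rewrite [ext_subst phi x]/ext_subst linear_sum /= [RHS]ext_decomp.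
apply: eq_bigr => A _; rewrite linearZ /= ext_subst_wedge.
congr (_ *: _); rewrite emonE /wedge; apply: eq_bigr => i _.
by rewrite ext_subst_linear_forms phib linear_forms1.
Qed.
End WedgeProducts.

(** * Initial monomials and exterior shifting *)

Lemma memv_sum_lineP (K : fieldType) (vT : vectType K) (I : finType) (P : pred I)
    (w : I -> vT) v :
  reflect (exists c : I -> K, v = \sum_(i | P i) c i *: w i)
          (v \in \sum_(i | P i) <[w i]>)%VS.
Proof.
apply: (iffP memv_sumP) => [[u uP ->]|[c ->]]; last first.
  by exists (fun i => c i *: w i) => // i _; rewrite memvZ ?memv_line.
have /fin_all_exists[c cP] : forall i, exists c, P i -> u i = c *: w i.
  move=> i; case Pi: (P i); last by exists 0.
  by have /vlineP[c ->] := uP i Pi; exists c.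
by exists c; apply: eq_bigr.
Qed.

Section Shifting.
Variables (K : fieldType) (n : nat).
Local Notation E := (exterior K n).
Implicit Types (A B C D F G : {set 'I_n}) (x y : E) (f : 'I_n -> E).
Implicit Types (a b phi : 'M[K]_n).

Lemma lexlt_irr A : lexlt A A = false.
Proof. by apply/existsP => -[i]; rewrite setDv inE. Qed.

(** Adjoining a disjoint set leaves both set differences unchanged, and [lexlt] depends on nothing
    else. *)
Lemma lexltU A B D : [disjoint A & D] -> [disjoint B & D] ->
  lexlt A B -> lexlt (A :|: D) (B :|: D).
Proof.
have disjD A' B' : [disjoint A' & D] -> (A' :|: D) :\: (B' :|: D) = A' :\: B'.
  move=> dA; apply/setP => k; rewrite !inE negb_or.
  case: (boolP (k \in D)) => kD; last by rewrite andbT orbF.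
  by rewrite (disjointFl dA kD) !andbF.
by move=> dA dB; rewrite /lexlt !disjD.
Qed.

Definition lex_predecessor A : pred {set 'I_n} :=
  fun B => (#|B| == #|A|) && lexlt B A.

Definition lex_span (Delta : {set {set 'I_n}}) a A : {vspace E} :=
  (\sum_(B | lex_predecessor A B) <[wedge (linear_forms a) B]>
   + face_ideal K Delta)%VS.

Variables (Delta : {set {set 'I_n}}) (hDelta : hereditary Delta).

Lemma mem_face_ideal x :
  reflect (forall F, F \in Delta -> x F = 0) (x \in face_ideal K Delta).
Proof.
rewrite face_ideal_monomial //; apply: (iffP (monomial_spaceP _ _)) => xP F.
  by move=> FD; apply/eqP; apply: contraTT FD => /xP.
by apply: contraNN => /xP ->.
Qed.

(** Modulo the face ideal only the coordinates at faces survive, so membership becomes solvability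
    of a linear system indexed by the faces. *)
Lemma lex_spanP a A x :
  reflect (exists c : {set 'I_n} -> K, forall F, F \in Delta ->
      x F = \sum_(B | lex_predecessor A B) c B * wedge (linear_forms a) B F)
    (x \in lex_span Delta a A).
Proof.
apply: (iffP memv_addP) => [[_ /memv_sum_lineP[c ->] [y /mem_face_ideal y0 ->]]|[c cP]].
  exists c => F FD; rewrite ffunE y0 // addr0 sum_ffunE.
  by apply: eq_bigr => B _; rewrite ffunE.
exists (\sum_(B | lex_predecessor A B) c B *: wedge (linear_forms a) B).
  by apply/memv_sum_lineP; exists c.
exists (x - \sum_(B | lex_predecessor A B) c B *: wedge (linear_forms a) B).
  apply/mem_face_ideal => F FD; rewrite !ffunE cP // sum_ffunE.
  by apply/eqP; rewrite subr_eq0; apply/eqP/eq_bigr => B _; rewrite ffunE.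
by rewrite addrC subrK.
Qed.

(** The size bound is automatic: the wedge is homogeneous of degree [#|A|], and in degrees above all
    faces everything lies in the face ideal. *)
Lemma mem_exterior_shifting a A :
  (A \in exterior_shifting a Delta) = (wedge (linear_forms a) A \notin lex_span Delta a A).
Proof.
rewrite inE -/(lex_span _ _ _); apply/andb_idl; apply: contraNT.
rewrite -ltnNge => ltA; apply: (subvP (addvSr _ _)); apply/mem_face_ideal => F FD.
apply/eqP; apply: contraTT ltA => /wedge_degree <-; rewrite -leqNgt.
exact: (bigmax_sup F FD).
Qed.

(** A relation expressing the wedge at [F] by predecessors is multiplied on the right by the wedge
    at [G :\: F]. Each predecessor term dies or becomes, up to sign, the wedge of a predecessor of
    [G], and the face ideal is stable. *)
Lemma exterior_shifting_hereditary a : hereditary (exterior_shifting a Delta).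
Proof.
move=> F G; rewrite !mem_exterior_shifting => nG FG; apply: contra nG.
set f := linear_forms a; have fC : anticommuting f by apply: linear_forms_anticommuting.
have dFG : [disjoint F & G :\: F] by rewrite disjoint_sym disjoints_subset subsetDr.
have eG : F :|: (G :\: F) = G by rewrite setDE setUIr setUCr setIT (setUidPr FG).
have -> : wedge f G = (ext_sign K F (G :\: F))^-1 *: (wedge f F * wedge f (G :\: F)).
  by rewrite wedgeM // dFG scalerA mulVf ?signr_eq0 // scale1r eG.
case/memv_addP => _ /memv_sum_lineP[c ->] [y /mem_face_ideal y0 ->].
rewrite memvZ // mulrDl memv_add //.
  rewrite mulr_suml; apply: memv_suml => B /andP[/eqP cB ltB].
  rewrite -scalerAl wedgeM //; case: ifP => dB; last by rewrite scaler0 mem0v.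
  rewrite !memvZ //; apply: (subvP (sumv_sup (B :|: (G :\: F)) _ (subvv _))).
    have ltU := lexltU dB dFG ltB; rewrite eG in ltU.
    rewrite /lex_predecessor ltU andbT -[X in _ == X](cardsID F G) (setIidPr FG).
    by rewrite cardsU disjoint_setI0 // cards0 subn0 cB.
  exact: memv_line.
apply/mem_face_ideal => H HD; apply/eqP; apply: contraTT HD.
case/ext_mul_neq0 => C [sCH yC _]; apply: contraNN yC => HD.
by rewrite y0 //; apply: hDelta HD sCH.
Qed.

Lemma initial_monomial_shifting phi b A : phi *m b = 1%:M -> b *m phi = 1%:M ->
  (exists (j : int) (x : E),
     [/\ x \in (linfun (ext_subst phi) @: face_ideal K Delta)%VS,
         x \in ext_deg K n j & initial_monomial x A]) <->
  A \notin exterior_shifting b Delta.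
Proof.
move=> phib bphi; rewrite mem_exterior_shifting negbK; split.
  case=> j [x [/memv_imgP[y yJ xy]]]; rewrite lfunE /= in xy.
  rewrite ext_degE => /monomial_spaceP xj [xA ltA].
  (* Pulling [x] back by [b] turns each monomial into a wedge of [b]; the nonzero coefficient at [A]
     then allows solving for the wedge at [A]. *)
  have: ext_subst b x = y by rewrite xy ext_substK.
  rewrite /ext_subst (bigD1 A) //= => /(canRL (addrK _)) eA.
  rewrite -[wedge _ A]scale1r -(mulVf xA) -scalerA memvZ // eA rpredB //.
    exact: (subvP (addvSr _ _)).
  apply: memv_suml => B nBA; have [->|xB] := eqVneq (x B) 0.
    by rewrite scale0r mem0v.
  apply/memvZ/(subvP (addvSl _ _))/(subvP (sumv_sup B _ (subvv _))); last exact: memv_line.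
  rewrite /lex_predecessor ltA // andbT.
  by have := xj B xB; rewrite -(eqP (xj A xA)).
case/memv_addP => _ /memv_sum_lineP[c ->] [y yJ eA].
have wE B : ext_subst phi (wedge (linear_forms b) B) = emon K B.
  by rewrite -ext_substE ext_substK.
(* The image of the error term [y] is [emon A] minus a combination of smaller monomials, hence an
   element with initial monomial [A]. *)
have eB B : ext_subst phi y B =
    (B == A)%:R - \sum_(C | lex_predecessor A C) c C * (B == C)%:R.
  have yE : y = wedge (linear_forms b) A -
      \sum_(C | lex_predecessor A C) c C *: wedge (linear_forms b) C.
    by rewrite eA addrAC subrr add0r.
  have -> : ext_subst phi y = emon K A - \sum_(C | lex_predecessor A C) c C *: emon K C.
    rewrite yE linearB [X in _ - X]linear_sum /= wE; congr (_ - _).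
    by apply: eq_bigr => C _; rewrite linearZ /= wE.
  rewrite !ffunE sum_ffunE; congr (_ - _).
  by apply: eq_bigr => C _; rewrite !ffunE.
have xE B : B != A -> ext_subst phi y B != 0 -> lex_predecessor A B.
  move=> /negbTE nBA; apply: contraNT => nB; rewrite eB nBA sub0r oppr_eq0.
  rewrite big1 // => C sAC; case: eqP => [e|]; last by rewrite mulr0.
  by rewrite e sAC in nB.
exists #|A|, (ext_subst phi y); split.
- by apply/memv_imgP; exists y => //; rewrite lfunE.
- rewrite ext_degE; apply/monomial_spaceP => B.
  by have [->//|nBA] := eqVneq B A; move/(xE _ nBA)/andP => [/eqP ->].
- split; last by move=> B xB nBA; have /andP[] := xE B nBA xB.
  rewrite eB eqxx big1 ?subr0 ?oner_eq0 // => C /andP[_ ltC].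
  by case: eqP => [e|]; [rewrite -e lexlt_irr in ltC | rewrite mulr0].
Qed.
End Shifting.

(** * The shifting at a generic matrix *)

Section MinorsAndRank.
Variables (F : fieldType) (m k : nat) (N : 'M[F]_(m, k)).

(** A maximal independent set of rows is chosen first, then a maximal independent set of columns of
    the resulting submatrix. *)
Lemma rank_minor : exists (f : 'I_(\rank N) -> 'I_m) (g : 'I_(\rank N) -> 'I_k),
  \det (mxsub f g N) != 0.
Proof.
pose M := rowsub (maxrankfun N) N; have Mfree : row_free M := maxrowsub_free N.
have MTfull : row_full M^T by rewrite /row_full mxrank_tr.
exists (maxrankfun N), (fullrankfun MTfull).
have := fullrowsub_unit MTfull; rewrite unitmxE unitfE -det_tr.
by congr (\det _ != 0); apply/matrixP => i j; rewrite !mxE.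
Qed.

Lemma minor_rank r (f : 'I_r -> 'I_m) (g : 'I_r -> 'I_k) :
  \det (mxsub f g N) != 0 -> (r <= \rank N)%N.
Proof.
rewrite -unitfE -unitmxE -row_free_unit => /eqP <-.
rewrite mxsubrc rowsubE; apply: leq_trans (mxrankM_maxr _ _) _.
rewrite -mxrank_tr -[leqRHS]mxrank_tr.
have -> : (colsub g N)^T = rowsub g N^T by apply/matrixP => i j; rewrite !mxE.
by rewrite rowsubE mxrankM_maxr.
Qed.
End MinorsAndRank.

(** The witness is a maximal minor that is nonzero under the injective [theta]; its survival under
    [psi] bounds the rank below. The rank cannot be larger, since a minor nonzero under [psi] is
    nonzero in [R] and so under [theta]. *)
Lemma generic_rank (R : comNzRingType) (F : fieldType) (theta : {rmorphism R -> F})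
    m k (M : 'M[R]_(m, k)) : (forall r, theta r = 0 -> r = 0) ->
  exists2 p : R, p != 0 &
    forall (L : fieldType) (psi : {rmorphism R -> L}), psi p != 0 ->
      \rank (map_mx psi M) = \rank (map_mx theta M).
Proof.
move=> inj_theta; have [f [g nzdet]] := rank_minor (map_mx theta M).
rewrite -map_mxsub det_map_mx in nzdet.
exists (\det (mxsub f g M)).
  by apply: contraNneq nzdet => ->; rewrite rmorph0.
move=> L psi nz; apply/eqP; rewrite eqn_leq; apply/andP; split; last first.
  by apply: (@minor_rank _ _ _ _ _ f g); rewrite -map_mxsub det_map_mx.
have [f' [g' nzdet']] := rank_minor (map_mx psi M).
apply: (@minor_rank _ _ _ _ _ f' g').
rewrite -map_mxsub det_map_mx; rewrite -map_mxsub det_map_mx in nzdet'.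
by apply: contraNneq nzdet' => /inj_theta ->; rewrite rmorph0.
Qed.

Lemma submx_rank (F : fieldType) m1 m2 k (u : 'M[F]_(m1, k)) (N : 'M[F]_(m2, k)) :
  (u <= N)%MS = (\rank (col_mx N u) == \rank N).
Proof.
rewrite -addsmxE eq_sym (mxrank_leqif_sup (addsmxSl N u)).
by rewrite addsmx_sub submx_refl.
Qed.

(** * Wedge coefficients as polynomials, and the shifting as a rank condition *)

Section GenericShifting.
Variables (K : fieldType) (n : nat).
Implicit Types (A B F : {set 'I_n}) (s : seq 'I_n).
Local Notation P := {mpoly K[n * n]}.

(* The coefficient of e_F in the product of the generic linear forms indexed by s. *)
Fixpoint prod_poly s F : P :=
  if s is i :: s' then
    \sum_(A : {set 'I_n} | A \subset F) (-1) ^+ inversions A (F :\: A) *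
      (\sum_j 'X_(mxvec_index i j) * (A == [set j])%:R) * prod_poly s' (F :\: A)
  else (F == set0)%:R.

Lemma prod_polyE (L : fieldType) (h : {rmorphism K -> L}) (b : 'M[L]_n) s F :
  mmap h (fun k => mxvec b 0 k) (prod_poly s F) =
  (\prod_(i <- s) linear_forms b i : exterior L n) F.
Proof.
elim: s F => [|i s IHs] F.
  by rewrite big_nil rmorph_nat ffunE.
rewrite big_cons ffunE rmorph_sum; apply: eq_bigr => A AF.
rewrite !rmorphM rmorphXn rmorphN1 /= IHs; congr (_ * _ * _).
rewrite sum_ffunE rmorph_sum; apply: eq_bigr => j _.
by rewrite rmorphM rmorph_nat /= mmapX mmap1U mxvecE !ffunE.
Qed.

(** Unwanted rows and the columns of nonfaces are set to zero rather than removed, which keeps one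
    matrix size throughout. Dropping the nonfaces amounts to working modulo the face ideal. *)
Definition coordinate_mx (R : nzRingType) (Delta : {set {set 'I_n}})
    (Q : pred {set 'I_n}) (w : {set 'I_n} -> {set 'I_n} -> R) :
    'M[R]_(#|{set 'I_n}|, #|{set 'I_n}|) :=
  \matrix_(r, c) (if Q (enum_val r) && (enum_val c \in Delta)
                  then w (enum_val r) (enum_val c) else 0).

Lemma map_coordinate_mx (R S : nzRingType) (h : {rmorphism R -> S}) Delta Q
    (w : {set 'I_n} -> {set 'I_n} -> R) v : (forall A F, h (w A F) = v A F) ->
  map_mx h (coordinate_mx Delta Q w) = coordinate_mx Delta Q v.
Proof.
by move=> hw; apply/matrixP => r c; rewrite !mxE; case: ifP; rewrite ?hw ?rmorph0.
Qed.

Lemma shifting_rank (L : fieldType) (b : 'M[L]_n) Delta A : hereditary Delta ->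
  (A \in exterior_shifting b Delta) =
  let w (B F : {set 'I_n}) := wedge (linear_forms b) B F : L in
  (\rank (col_mx (coordinate_mx Delta (lex_predecessor A) w)
                 (coordinate_mx Delta (pred1 A) w)) !=
   \rank (coordinate_mx Delta (lex_predecessor A) w)).
Proof.
move=> hD /=; set w := fun _ => _; rewrite mem_exterior_shifting // -submx_rank; congr (~~ _).
apply/(lex_spanP hD)/submxP => [[c cP]|[C eC]].
(* The matrix for [pred1 A] has at most one nonzero row, the one of [A], so only that row needs the
   coefficients [c]. *)
- exists (\matrix_(r, s) if enum_val r == A then c (enum_val s) else 0).
  apply/matrixP => r s; rewrite !mxE /=.
  case: (enum_val r =P A) => [rA|nA] /=; last first.
    by rewrite big1 // => t _; rewrite !mxE; case: eqP => // _; rewrite mul0r.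
  rewrite [RHS](reindex_onto enum_rank enum_val) /=; last by move=> ? _; rewrite enum_valK.
  case: ifP => FD; last first.
    by rewrite big1 // => B _; rewrite !mxE FD andbF mulr0.
  rewrite /w rA cP // [LHS]big_mkcond /= [RHS](eq_bigl xpredT) => [|B]; last first.
    by rewrite enum_rankK eqxx.
  apply: eq_bigr => B _; rewrite !mxE !enum_rankK rA eqxx FD andbT.
  by case: ifP; rewrite ?mulr0.
- exists (fun B => C (enum_rank A) (enum_rank B)) => F FD.
  have /matrixP/(_ (enum_rank A) (enum_rank F)) := eC.
  rewrite !mxE !enum_rankK /= eqxx FD /= /w => ->.
  rewrite [LHS](reindex_onto enum_rank enum_val) /=; last by move=> ? _; rewrite enum_valK.
  rewrite [RHS]big_mkcond /= [LHS](eq_bigl xpredT) => [|B]; last first.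
    by rewrite enum_rankK eqxx.
  apply: eq_bigr => B _; rewrite !mxE !enum_rankK FD andbT.
  by case: ifP; rewrite ?mulr0.
Qed.

Variables (K' : fieldType) (iota : {rmorphism K -> K'}) (a : 'M[K']_n).

(** Algebraic independence says that evaluation at [a] is injective on polynomials, so
    [generic_rank] applies to the two ranks attached to each [A]. The product over the finitely many
    [A] serves for all at once. *)
Lemma generic_shifting Delta : alg_independent iota a -> hereditary Delta ->
  exists2 p : P, p != 0 &
    forall b : 'M[K]_n, p.@[fun k => mxvec b 0 k] != 0 ->
      exterior_shifting b Delta = exterior_shifting a Delta.
Proof.
move=> ha hD; pose w A F := prod_poly (enum A) F.
pose theta : {rmorphism P -> K'} := mmap iota (fun k => mxvec a 0 k).
have wE (L : fieldType) (h : {rmorphism K -> L}) (b : 'M[L]_n) Q :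
    map_mx (mmap h (fun k => mxvec b 0 k)) (coordinate_mx Delta Q w) =
    coordinate_mx Delta Q (fun B F => wedge (linear_forms b) B F : L).
  by apply: map_coordinate_mx => A F; apply: prod_polyE.
have /fin_all_exists2[p p0 pP] : forall A, exists2 p : P, p != 0 &
    forall b : 'M[K]_n, p.@[fun k => mxvec b 0 k] != 0 ->
      (A \in exterior_shifting b Delta) = (A \in exterior_shifting a Delta).
  move=> A; pose N := coordinate_mx Delta (lex_predecessor A) w.
  pose N' := coordinate_mx Delta (pred1 A) w.
  have [p p0 pP] := @generic_rank _ _ theta _ _ N ha.
  have [q q0 qP] := @generic_rank _ _ theta _ _ (col_mx N N') ha.
  exists (p * q) => [|b]; first by rewrite mulf_neq0.
  rewrite mevalM mulf_eq0 negb_or => /andP[/(pP _ (meval _)) eqp /(qP _ (meval _)) eqq].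
  (* One polynomial matrix specialises to both sides, along [iota] at [a] and along the identity at
     [b]. *)
  rewrite !shifting_rank //= -!(wE _ iota a) -!(wE _ (@idfun K) b) -!map_col_mx.
  by congr (_ != _); [apply: eqq|apply: eqp].
exists (\prod_A p A).
  by apply/prodf_neq0 => A _.
move=> b; rewrite rmorph_prod => /prodf_neq0 nz; apply/setP => A.
by apply: pP; apply: nz.
Qed.
End GenericShifting.

(** * The generic initial ideal *)

Section InfiniteFields.
Variables (K : fieldType) (hK : infinite_field K).

Lemma poly_nonroot (p : {poly K}) : p != 0 -> exists x, p.[x] != 0.
Proof.
move=> p0; have [s us ss] : exists2 s : seq K, uniq s & size s = size p.
  elim: (size p) => [|m [s us <-]]; first by exists [::].
  by have [x xs] := hK s; exists (x :: s); rewrite //= xs.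
have /allPn[x _ nx] : ~~ all (root p) s.
  by apply/negP => /(max_poly_roots p0)/(_ us); rewrite ss ltnn.
by exists x.
Qed.

(** Induction on the number of variables: [muni] views [p] as a polynomial in the last variable,
    whose leading coefficient is kept nonzero by a choice of the other coordinates. *)
Lemma mpoly_nonroot m (p : {mpoly K[m]}) : p != 0 -> exists v, p.@[v] != 0.
Proof.
elim: m p => [|m IHm] p p0.
  have pC : p = (p@_0)%:MP.
    apply/mpolyP => u; have -> : u = 0%MM by apply/mnmP => -[].
    by rewrite mcoeffC eqxx mulr1.
  exists (fun=> 0); apply: contraNneq p0; rewrite pC mevalC => ->.
  by rewrite mpolyC0.
pose w : 'I_m -> 'I_m.+1 := widen_ord (leqnSn m).
(* The leading monomial of [p] is recovered from its last exponent and the remaining ones, so no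
   other term contributes to the same coefficient. *)
have muni_neq0 : muni p != 0.
  have : mlead p \in msupp p by rewrite mcoeff_msupp mleadc_eq0.
  set m0 := mlead p; move=> m0p.
  apply: contraTneq (m0p) => mu0; rewrite mcoeff_msupp negbK.
  have : ((muni p)`_(m0 ord_max))@_[multinom m0 (w i) | i < m] = 0.
    by rewrite mu0 coef0 mcoeff0.
  rewrite muniE coef_sum raddf_sum /= (bigD1_seq m0) ?msupp_uniq //= big1 => [|u nu].
    by rewrite coefZ coefXn eqxx mulr1 mcoeffZ mcoeffX eqxx mulr1 addr0 => ->.
  rewrite coefZ coefXn; case: eqP => [e|_]; last by rewrite mulr0 mcoeff0.
  rewrite mulr1 mcoeffZ mcoeffX; case: eqP => [/mnmP e'|_]; last by rewrite mulr0.
  case/eqP: nu; apply/mnmP => i; case: (unliftP ord_max i) => [k ->|->] //.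
  have := e' k; rewrite !mnmE; congr (u _ = m0 _); apply/val_inj => /=.
    by rewrite /bump leqNgt ltn_ord.
  by rewrite /bump leqNgt ltn_ord.
have /IHm[v vP] : (lead_coef (muni p)) != 0 by rewrite lead_coef_eq0.
have : map_poly (meval v) (muni p) != 0.
  by apply: contraNneq vP => e; rewrite -coef_map /= e coef0.
case/poly_nonroot => x xP.
exists (fun i => if unlift ord_max i is Some j then v j else x).
move: xP; congr (_ != 0).
rewrite muniE rmorph_sum horner_sum mevalE; apply: eq_bigr => u _ /=.
rewrite map_polyZ map_polyXn hornerZ hornerXn /= mevalZ mevalX -mulrA; congr (_ * _).
rewrite big_ord_recr /= unlift_none; congr (_ * _); apply: eq_bigr => k _.
have -> : widen_ord (leqnSn m) k = lift ord_max k.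
  by apply/val_inj; rewrite /= /bump leqNgt ltn_ord.
by rewrite liftK mnmE; congr (v k ^+ u _); apply/val_inj; rewrite /= /bump leqNgt ltn_ord.
Qed.
End InfiniteFields.

(** * Uniqueness and computation of the generic initial ideal *)

Section GenericInitialIdeal.
Variables (K : fieldType) (hK : infinite_field K) (n : nat).
Implicit Types (phi b : 'M[K]_n) (J G : {vspace exterior K n}).

(* Using c *: \adj phi, proportional to the inverse of phi, instead of the
   inverse itself keeps the conditions on phi polynomial. *)
Lemma mpoly_eval_adj (c : K) (p : {mpoly K[n * n]}) :
  exists q : {mpoly K[n * n]}, forall phi,
    q.@[fun k => mxvec phi 0 k] = p.@[fun k => mxvec (c *: \adj phi) 0 k].
Proof.
pose X : 'M[{mpoly K[n * n]}]_n := \matrix_(i, j) 'X_(mxvec_index i j).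
pose Y := mxvec (c%:MP *: \adj X).
exists (p \mPo [tuple Y 0 k | k < n * n]) => phi.
rewrite comp_mpoly_meval; apply: meval_eq => k; rewrite tnth_mktuple.
have eX : map_mx (meval (fun k => mxvec phi 0 k)) X = phi.
  by apply/matrixP => i j; rewrite !mxE /= mevalXU mxvecE.
rewrite -[X in _ = mxvec (_ *: \adj X) _ _]eX -map_mx_adj.
by case/mxvec_indexP: k => i j; rewrite !mxvecE !mxE mevalM mevalC.
Qed.

Lemma det_poly : exists q : {mpoly K[n * n]}, forall phi,
  q.@[fun k => mxvec phi 0 k] = \det phi.
Proof.
exists (\det (\matrix_(i, j) 'X_(mxvec_index i j))) => phi.
rewrite -[LHS]det_map_mx; congr (\det _).
by apply/matrixP => i j; rewrite !mxE /= mevalXU mxvecE.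
Qed.

(** A non-root of the product of one nonvanishing polynomial from each set and the determinant gives
    a common invertible point. *)
Lemma zariski_open_GL_meet (U V : 'M[K]_n -> Prop) :
  zariski_open_GL U -> zariski_open_GL V ->
  (exists phi, U phi) -> (exists phi, V phi) -> exists phi, U phi /\ V phi.
Proof.
move=> [S SP] [T TP] [x /SP[_ [p Sp px]]] [y /TP[_ [q Tq qy]]].
have nz (r : {mpoly K[n * n]}) v : r.@[v] != 0 -> r != 0.
  by apply: contraNneq => ->; rewrite meval0.
have [d dP] := det_poly.
have /(mpoly_nonroot hK)[v] : p * q * d != 0.
  rewrite !mulf_neq0 //; [exact: nz px|exact: nz qy|].
  by apply: (nz _ (fun k => mxvec 1%:M 0 k)); rewrite dP det1 oner_eq0.
pose phi : 'M[K]_n := vec_mx (\row_k v k).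
have -> r : r.@[v] = r.@[fun k => mxvec phi 0 k].
  by apply: meval_eq => k; rewrite vec_mxK mxE.
rewrite !mevalM !mulf_eq0 !negb_or dP => /andP[/andP[pv qv]].
rewrite -unitfE -unitmxE => uv.
by exists phi; split; [apply/SP|apply/TP]; split=> //; [exists p|exists q].
Qed.

Lemma is_gin_unique J G1 G2 : is_gin J G1 -> is_gin J G2 -> G1 = G2.
Proof.
move=> [U [oU neU UG]] [V [oV neV VG]].
by have [phi [/UG <- /VG]] := zariski_open_GL_meet oU oV neU neV.
Qed.

Lemma ginE J G : is_gin J G -> gin J = G.
Proof.
move=> JG; rewrite /gin; case: pselect => [exG|[]]; last by exists G.
exact: is_gin_unique (svalP (cid exG)) JG.
Qed.

(** Every wedge is multiplied by a nonzero power of [c], so the lines they span do not move. This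
    permits replacing an inverse by a multiple of the adjugate. *)
Lemma exterior_shiftingZ Delta (c : K) b : c != 0 -> hereditary Delta ->
  exterior_shifting (c *: b) Delta = exterior_shifting b Delta.
Proof.
move=> c0 hD; apply/setP => A; rewrite !mem_exterior_shifting //.
have wZ B : wedge (linear_forms (c *: b)) B = c ^+ #|B| *: wedge (linear_forms b) B.
  rewrite -wedgeZ /wedge; apply: eq_bigr => i _; rewrite /linear_forms scaler_sumr.
  by apply: eq_bigr => j _; rewrite mxE scalerA.
rewrite wZ; congr (~~ _).
have -> : lex_span Delta (c *: b) A = lex_span Delta b A.
  congr (_ + _)%VS; apply: eq_bigr => B _; rewrite wZ; apply/vspaceP => x.
  have cB : c ^+ #|B| != 0 by rewrite expf_neq0.
  apply/vlineP/vlineP => -[k ->]; last first.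
    by exists (k / c ^+ #|B|); rewrite scalerA divfK.
  by exists (k * c ^+ #|B|); rewrite scalerA.
by rewrite rpredZeq expf_eq0 (negbTE c0) andbF.
Qed.

Variables (K' : fieldType) (iota : {rmorphism K -> K'}) (a : 'M[K']_n).
Variables (Delta : {set {set 'I_n}}).
Hypotheses (ha : alg_independent iota a) (hDelta : hereditary Delta).

Lemma gin_face_ideal :
  gin (face_ideal K Delta) = face_ideal K (exterior_shifting a Delta).
Proof.
apply: ginE; have [p p0 pP] := generic_shifting ha hDelta.
(* This is a union of open sets, one for each nonzero scalar [c]; the freedom in [c] lets the
   multiple of the adjugate equal any prescribed invertible matrix. *)
exists (fun phi => phi \in unitmx /\ exists2 c, c != 0 &
          p.@[fun k => mxvec (c *: \adj phi) 0 k] != 0); split.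
- exists (fun q => exists2 c, c != 0 & forall phi,
    q.@[fun k => mxvec phi 0 k] = p.@[fun k => mxvec (c *: \adj phi) 0 k]) => phi.
  split=> -[uphi]; first case=> c c0 pc; last case=> q [c c0 qP].
    split=> //; have [q qP] := mpoly_eval_adj c p.
    by exists q; [exists c | rewrite qP].
  by rewrite qP; split=> //; exists c.
- have [d dP] := det_poly.
  have d0 : d != 0.
    apply: contraTneq isT => d0; have := dP 1%:M.
    by rewrite d0 meval0 det1 => /eqP; rewrite eq_sym oner_eq0.
  have /(mpoly_nonroot hK)[v] : p * d != 0 by rewrite mulf_neq0.
  pose b : 'M[K]_n := vec_mx (\row_k v k).
  have -> : (p * d).@[v] = (p * d).@[fun k => mxvec b 0 k].
    by apply: meval_eq => k; rewrite vec_mxK mxE.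
  rewrite mevalM mulf_eq0 negb_or dP => /andP[pv]; rewrite -unitfE -unitmxE => ub.
  (* The adjugate of the inverse of [b] is [b] divided by its determinant, hence the scalar
     [\det b]. *)
  exists (invmx b); split; first by rewrite unitmx_inv.
  exists (\det b); first by rewrite -unitfE -unitmxE.
  suff -> : \det b *: \adj (invmx b) = b by [].
  have := mul_adj_mx (invmx b); rewrite det_inv => /(congr1 (mulmx^~ b)).
  rewrite -mulmxA mulVmx // mulmx1 => ->.
  by rewrite mul_scalar_mx scalerA divff ?scale1r // -unitfE -unitmxE.
move=> phi [uphi [c c0 /pP shE]].
rewrite /initial_ideal [RHS]/face_ideal; congr (ext_ideal _); apply: eq_bigl => A.
have dphi : \det phi != 0 by rewrite -unitfE -unitmxE.
have l0 : c * \det phi != 0 by rewrite mulf_neq0.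
(* This is the inverse of [phi], written as a multiple of the matrix at which [p] is known not to
   vanish. *)
pose b := (c * \det phi)^-1 *: (c *: \adj phi).
have phib : phi *m b = 1%:M.
  rewrite -!scalemxAr mul_mx_adj !scale_scalar_mx; congr (_%:M).
  by rewrite mulVf.
have bphi : b *m phi = 1%:M by apply: mulmx1C.
rewrite -shE -(exterior_shiftingZ _ (_ : (c * \det phi)^-1 != 0)) ?invr_eq0 //.
by apply/asboolP/idP => /(initial_monomial_shifting hDelta _ phib bphi).
Qed.
End GenericInitialIdeal.

Theorem corollary3p10 (K : fieldType) (hK : infinite_field K)
    (n : nat) (Delta : {set {set 'I_n}}) (hDelta : simplicial_complex Delta)
    (K' : fieldType) (iota : {rmorphism K -> K'})
    (a : 'M[K']_n) (ha : alg_independent iota a)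
    (i : 'I_n) (j : int) :
  generic_annihilator_number (face_ideal K Delta) i j =
  #|[set F in exterior_shifting a Delta |
      [&& #|F|%:Z == j,
          [set k : 'I_n | (k <= i)%N] :&: F == set0 &
          F :|: [set i] \notin exterior_shifting a Delta]]|.
Proof.
have hD : hereditary Delta by move=> F G GD FG; case: hDelta => _; apply; eassumption.
rewrite /generic_annihilator_number (gin_face_ideal hK ha hD).
exact/annihilator_number_face_ideal/exterior_shifting_hereditary.
Qed.
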